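(* Let $(\mathcal C,\otimes,I,\gamma)$ be a symmetric monoidal category and $\mathcal T$ a strong monad on it. The following are equivalent: (1) for every object $X$ of $\mathcal C$, $\mathcal T$ admits a terminal central cone at $X$; (2) there exists a commutative submonad $\mathcal Z$ of $\mathcal T$ such that the canonical embedding functor $\mathcal I:\mathcal C_{\mathcal Z}\to\mathcal C_{\mathcal T}$ corestricts to an isomorphism of categories $\mathcal C_{\mathcal Z}\cong Z(\mathcal C_{\mathcal T})$; (3) the corestriction $\hat{\mathcal J}:\mathcal C\to Z(\mathcal C_{\mathcal T})$ of the Kleisli left adjoint $\mathcal J:\mathcal C\to\mathcal C_{\mathcal T}$ to the premonoidal centre is also a left adjoint.
   Context: $\mathcal T=(\mathcal T,\eta,\mu,\tau)$ with left strength $\tau_{X,Y}:X\otimes\mathcal TY\to\mathcal T(X\otimes Y)$ and right strength $\tau'_{X,Y}=\mathcal T(\gamma_{Y,X})\circ\tau_{Y,X}\circ\gamma_{\mathcal TX,Y}$. Commutative: $\mu\circ\mathcal T\tau'\circ\tau=\mu\circ\mathcal T\tau\circ\tau'$. A central cone of $\mathcal T$ at $X$ is $(W,\iota)$ with $\iota:W\to\mathcal TX$ such that for all $Y$, $\mu\circ\mathcal T\tau'_{X,Y}\circ\tau_{\mathcal TX,Y}\circ(\iota\otimes\mathcal TY)=\mu\circ\mathcal T\tau_{X,Y}\circ\tau'_{X,\mathcal TY}\circ(\iota\otimes\mathcal TY)$; morphisms of central cones $\varphi:(W',\iota')\to(W,\iota)$ satisfy $\iota\circ\varphi=\iota'$,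 and a terminal central cone is terminal in this category. A morphism of strong monads $\iota:\mathcal S\Rightarrow\mathcal T$ is a natural transformation compatible with units, multiplications and strengths ($\iota\circ\eta^{\mathcal S}=\eta^{\mathcal T}$, $\iota\circ\mu^{\mathcal S}=\mu^{\mathcal T}\circ\mathcal T\iota\circ\iota_{\mathcal S}$, $\iota\circ\tau^{\mathcal S}=\tau^{\mathcal T}\circ(X\otimes\iota)$); a commutative submonad is a commutative strong monad with such a $\iota$ that is a monomorphism in the category of strong monads. Kleisli category $\mathcal C_{\mathcal T}$: morphisms $X\to\mathcal TY$, composition $g\odot f=\mu\circ\mathcal Tg\circ f$; $\mathcal J$ is identity on objects and $f\mapsto\eta\circ f$. Canonical embedding $\mathcal I(f)=\iota_Y\circ f$. For $f:Y\to\mathcal TZ$, $f\otimes_l X=\tau'_{Z,X}\circ(f\otimes X)$, $X\otimes_r f=\tau_{X,Z}\circ(X\otimes f)$; $f:X\to\mathcal TY$ is central if $(f\otimes_l Y')\odot(X\otimes_r f')=(Y\otimes_r f')\odot(f\otimes_l X')$ for all $f':X'\to\mathcal TY'$. The premonoidal centre $Z(\mathcal C_{\mathcal T})$ is the subcategory with all objects and central morphisms; $\mathcal J$ always lands in it, giving the corestriction $\hat{\mathcal J}$. *)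

(* Defs.v *)
From mathcomp Require Export ssreflect ssrfun ssrbool eqtype ssrnat seq.
From Stdlib Require Import FunctionalExtensionality ProofIrrelevance.

Set Implicit Arguments.
Unset Strict Implicit.
Unset Printing Implicit Defensive.
#[local] Obligation Tactic := idtac.

Declare Scope cat_scope.
Delimit Scope cat_scope with cat.
Local Open Scope cat_scope.

Record category := Category {
  obj :> Type;
  hom : obj -> obj -> Type;
  idm : forall X, hom X X;
  comp : forall X Y Z, hom Y Z -> hom X Y -> hom X Z;
  comp_idl : forall X Y (f : hom X Y), comp (idm Y) f = f;
  comp_idr : forall X Y (f : hom X Y), comp f (idm X) = f;
  comp_assoc : forall X Y Z W (h : hom Z W) (g : hom Y Z) (f : hom X Y),
    comp h (comp g f) = comp (comp h g) f
}.
Arguments hom {c} X Y.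
Arguments idm {c} X.
Arguments comp {c X Y Z} g f.
Arguments comp_idl {c X Y} f.
Arguments comp_idr {c X Y} f.
Arguments comp_assoc {c X Y Z W} h g f.

Notation "g ∘ f" := (comp g f) (at level 40, left associativity) : cat_scope.

Definition is_iso (C : category) (X Y : C) (f : hom X Y) : Prop :=
  exists g : hom Y X, g ∘ f = idm X /\ f ∘ g = idm Y.

Definition monic (C : category) (X Y : C) (m : hom X Y) : Prop :=
  forall (W : C) (a b : hom W X), m ∘ a = m ∘ b -> a = b.

Definition terminal (C : category) (t : C) : Prop :=
  forall X : C, exists! f : hom X t, True.

Record functor (C D : category) := Functor {
  fobj :> C -> D;
  fmap : forall X Y : C, hom X Y -> hom (fobj X) (fobj Y);
  fmap_id : forall X : C, fmap (idm X) = idm (fobj X);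
  fmap_comp : forall (X Y Z : C) (g : hom Y Z) (f : hom X Y),
    fmap (g ∘ f) = fmap g ∘ fmap f
}.
Arguments fmap {C D} F {X Y} f : rename.
Arguments fmap_id {C D} F X : rename.
Arguments fmap_comp {C D} F {X Y Z} g f : rename.

Definition functor_id (C : category) : functor C C :=
  @Functor C C (fun X => X) (fun X Y f => f)
    (fun X => erefl) (fun X Y Z g f => erefl).

Program Definition functor_comp (C D E : category)
    (G : functor D E) (F : functor C D) : functor C E :=
  @Functor C E (fun X => G (F X)) (fun X Y f => fmap G (fmap F f)) _ _.
Next Obligation. by move=> C D E G F X /=; rewrite !fmap_id. Qed.
Next Obligation. by move=> C D E G F X Y Z g f /=; rewrite !fmap_comp. Qed.

Definition is_cat_isomorphism (C D : category) (F : functor C D) : Prop :=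
  exists G : functor D C,
    functor_comp G F = functor_id C /\ functor_comp F G = functor_id D.

Record adjunction (C D : category) (F : functor C D) (G : functor D C) :=
  Adjunction {
  adj_lr : forall (X : C) (Y : D), hom (F X) Y -> hom X (G Y);
  adj_rl : forall (X : C) (Y : D), hom X (G Y) -> hom (F X) Y;
  adj_lrK : forall (X : C) (Y : D) (f : hom (F X) Y), adj_rl (adj_lr f) = f;
  adj_rlK : forall (X : C) (Y : D) (g : hom X (G Y)), adj_lr (adj_rl g) = g;
  adj_nat : forall (X X' : C) (Y Y' : D)
      (a : hom X' X) (f : hom (F X) Y) (b : hom Y Y'),
    adj_lr (b ∘ f ∘ fmap F a) = fmap G b ∘ adj_lr f ∘ a
}.

Definition is_left_adjoint (C D : category) (F : functor C D) : Prop :=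
  exists G : functor D C, inhabited (adjunction F G).

Section WideSubcategory.
Variables (C : category) (P : forall X Y : C, hom X Y -> Prop).
Hypothesis P_id : forall X : C, P (idm X).
Hypothesis P_comp : forall (X Y Z : C) (g : hom Y Z) (f : hom X Y),
  P g -> P f -> P (g ∘ f).

Program Definition wide_subcategory : category :=
  @Category C (fun X Y => {f : hom X Y | P f})
    (fun X => exist _ (idm X) (P_id X))
    (fun X Y Z g f => exist _ (sval g ∘ sval f) (P_comp (svalP g) (svalP f)))
    _ _ _.
Next Obligation.
by move=> X Y f; apply: eq_sig_hprop => [*|]; [exact: proof_irrelevance|exact: comp_idl].
Qed.
Next Obligation.
by move=> X Y f; apply: eq_sig_hprop => [*|]; [exact: proof_irrelevance|exact: comp_idr].
Qed.
Next Obligation.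
by move=> X Y Z W h g f; apply: eq_sig_hprop => [*|];
  [exact: proof_irrelevance|exact: comp_assoc].
Qed.

Variables (D : category) (F : functor D C).
Hypothesis F_P : forall (X Y : D) (f : hom X Y), P (fmap F f).

Program Definition corestriction : functor D wide_subcategory :=
  @Functor D wide_subcategory (fun X => F X)
    (fun X Y f => exist _ (fmap F f) (F_P f)) _ _.
Next Obligation.
by move=> X; apply: eq_sig_hprop => [*|]; [exact: proof_irrelevance|exact: fmap_id].
Qed.
Next Obligation.
by move=> X Y Z g f; apply: eq_sig_hprop => [*|];
  [exact: proof_irrelevance|exact: fmap_comp].
Qed.

End WideSubcategory.

Record symmetric_monoidal_category := SymmetricMonoidalCategory {
  smc_category :> category;
  tens : smc_category -> smc_category -> smc_category;
  tensm : forall X Y X' Y' : smc_category,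
    hom X Y -> hom X' Y' -> hom (tens X X') (tens Y Y');
  munit : smc_category;
  assoc : forall X Y Z : smc_category,
    hom (tens (tens X Y) Z) (tens X (tens Y Z));
  lunit : forall X : smc_category, hom (tens munit X) X;
  runit : forall X : smc_category, hom (tens X munit) X;
  braid : forall X Y : smc_category, hom (tens X Y) (tens Y X);
  tensm_id : forall X Y : smc_category,
    tensm (idm X) (idm Y) = idm (tens X Y);
  tensm_comp : forall (X Y Z X' Y' Z' : smc_category)
      (g : hom Y Z) (f : hom X Y) (g' : hom Y' Z') (f' : hom X' Y'),
    tensm (g ∘ f) (g' ∘ f') = tensm g g' ∘ tensm f f';
  assoc_nat : forall (X X' Y Y' Z Z' : smc_category)
      (f : hom X X') (g : hom Y Y') (h : hom Z Z'),
    assoc X' Y' Z' ∘ tensm (tensm f g) h = tensm f (tensm g h) ∘ assoc X Y Z;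
  lunit_nat : forall (X Y : smc_category) (f : hom X Y),
    lunit Y ∘ tensm (idm munit) f = f ∘ lunit X;
  runit_nat : forall (X Y : smc_category) (f : hom X Y),
    runit Y ∘ tensm f (idm munit) = f ∘ runit X;
  braid_nat : forall (X X' Y Y' : smc_category) (f : hom X X') (g : hom Y Y'),
    braid X' Y' ∘ tensm f g = tensm g f ∘ braid X Y;
  assoc_iso : forall X Y Z : smc_category, is_iso (assoc X Y Z);
  lunit_iso : forall X : smc_category, is_iso (lunit X);
  runit_iso : forall X : smc_category, is_iso (runit X);
  pentagon : forall X Y Z W : smc_category,
    assoc X Y (tens Z W) ∘ assoc (tens X Y) Z W
    = tensm (idm X) (assoc Y Z W) ∘ assoc X (tens Y Z) W
      ∘ tensm (assoc X Y Z) (idm W);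
  triangle : forall X Y : smc_category,
    tensm (idm X) (lunit Y) ∘ assoc X munit Y = tensm (runit X) (idm Y);
  braid_unit : forall X : smc_category, lunit X ∘ braid X munit = runit X;
  hexagon : forall X Y Z : smc_category,
    assoc Y Z X ∘ braid X (tens Y Z) ∘ assoc X Y Z
    = tensm (idm Y) (braid X Z) ∘ assoc Y X Z ∘ tensm (braid X Y) (idm Z);
  braidK : forall X Y : smc_category, braid Y X ∘ braid X Y = idm (tens X Y)
}.
Arguments tens {s} X Y.
Arguments tensm {s X Y X' Y'} f g.
Arguments munit {s}.
Arguments assoc {s} X Y Z.
Arguments lunit {s} X.
Arguments runit {s} X.
Arguments braid {s} X Y.

Notation "X ⊗ Y" := (tens X Y) (at level 35, right associativity) : cat_scope.
Notation "f ⊗m g" := (tensm f g) (at level 35, right associativity) : cat_scope.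

Record monad (C : category) := Monad {
  monad_functor :> functor C C;
  eta : forall X : C, hom X (monad_functor X);
  mu : forall X : C, hom (monad_functor (monad_functor X)) (monad_functor X);
  eta_nat : forall (X Y : C) (f : hom X Y),
    eta Y ∘ f = fmap monad_functor f ∘ eta X;
  mu_nat : forall (X Y : C) (f : hom X Y),
    mu Y ∘ fmap monad_functor (fmap monad_functor f)
    = fmap monad_functor f ∘ mu X;
  mu_etal : forall X : C, mu X ∘ eta (monad_functor X) = idm (monad_functor X);
  mu_etar : forall X : C,
    mu X ∘ fmap monad_functor (eta X) = idm (monad_functor X);
  mu_mu : forall X : C,
    mu X ∘ mu (monad_functor X) = mu X ∘ fmap monad_functor (mu X)
}.
Arguments eta {C} T X : rename.
Arguments mu {C} T X : rename.

Record strong_monad (C : symmetric_monoidal_category) := StrongMonad {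
  strong_monad_monad :> monad C;
  tau : forall X Y : C,
    hom (X ⊗ strong_monad_monad Y) (strong_monad_monad (X ⊗ Y));
  tau_nat : forall (X X' Y Y' : C) (f : hom X X') (g : hom Y Y'),
    tau X' Y' ∘ (f ⊗m fmap strong_monad_monad g)
    = fmap strong_monad_monad (f ⊗m g) ∘ tau X Y;
  tau_lunit : forall X : C,
    fmap strong_monad_monad (lunit X) ∘ tau munit X
    = lunit (strong_monad_monad X);
  tau_assoc : forall X Y Z : C,
    fmap strong_monad_monad (assoc X Y Z) ∘ tau (X ⊗ Y) Z
    = tau X (Y ⊗ Z) ∘ (idm X ⊗m tau Y Z) ∘ assoc X Y (strong_monad_monad Z);
  tau_eta : forall X Y : C,
    tau X Y ∘ (idm X ⊗m eta strong_monad_monad Y)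
    = eta strong_monad_monad (X ⊗ Y);
  tau_mu : forall X Y : C,
    tau X Y ∘ (idm X ⊗m mu strong_monad_monad Y)
    = mu strong_monad_monad (X ⊗ Y) ∘ fmap strong_monad_monad (tau X Y)
      ∘ tau X (strong_monad_monad Y)
}.
Arguments tau {C} T X Y : rename.

Definition tau' (C : symmetric_monoidal_category) (T : strong_monad C)
    (X Y : C) : hom (T X ⊗ Y) (T (X ⊗ Y)) :=
  fmap T (braid Y X) ∘ tau T Y X ∘ braid (T X) Y.
Arguments tau' {C} T X Y.

Definition commutative (C : symmetric_monoidal_category) (T : strong_monad C)
    : Prop :=
  forall X Y : C,
    mu T (X ⊗ Y) ∘ fmap T (tau' T X Y) ∘ tau T (T X) Y
    = mu T (X ⊗ Y) ∘ fmap T (tau T X Y) ∘ tau' T X (T Y).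

Record strong_monad_morphism (C : symmetric_monoidal_category)
    (S T : strong_monad C) := StrongMonadMorphism {
  smm :> forall X : C, hom (S X) (T X);
  smm_nat : forall (X Y : C) (f : hom X Y),
    smm Y ∘ fmap S f = fmap T f ∘ smm X;
  smm_eta : forall X : C, smm X ∘ eta S X = eta T X;
  smm_mu : forall X : C,
    smm X ∘ mu S X = mu T X ∘ fmap T (smm X) ∘ smm (S X);
  smm_tau : forall X Y : C,
    smm (X ⊗ Y) ∘ tau S X Y = tau T X Y ∘ (idm X ⊗m smm Y)
}.

Lemma strong_monad_morphism_ext (C : symmetric_monoidal_category)
    (S T : strong_monad C) (a b : strong_monad_morphism S T) :
  (forall X, a X = b X) -> a = b.
Proof.
case: a b => [a a1 a2 a3 a4] [b b1 b2 b3 b4] /= ab.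
have {}ab : a = b by apply: functional_extensionality_dep.
by subst b; f_equal; apply: proof_irrelevance.
Qed.

Program Definition strong_monad_morphism_id (C : symmetric_monoidal_category)
    (T : strong_monad C) : strong_monad_morphism T T :=
  @StrongMonadMorphism C T T (fun X => idm (T X)) _ _ _ _.
Next Obligation. by move=> C T X Y f; rewrite comp_idl comp_idr. Qed.
Next Obligation. by move=> C T X; rewrite comp_idl. Qed.
Next Obligation. by move=> C T X; rewrite fmap_id comp_idl !comp_idr. Qed.
Next Obligation. by move=> C T X Y; rewrite tensm_id comp_idl comp_idr. Qed.

Program Definition strong_monad_morphism_comp (C : symmetric_monoidal_category)
    (R S T : strong_monad C) (b : strong_monad_morphism S T)
    (a : strong_monad_morphism R S) : strong_monad_morphism R T :=
  @StrongMonadMorphism C R T (fun X => b X ∘ a X) _ _ _ _.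
Next Obligation.
move=> C R S T b a X Y f.
by rewrite -comp_assoc smm_nat comp_assoc smm_nat comp_assoc.
Qed.
Next Obligation. by move=> C R S T b a X; rewrite -comp_assoc !smm_eta. Qed.
Next Obligation.
move=> C R S T b a X; rewrite -comp_assoc smm_mu !comp_assoc smm_mu fmap_comp.
by rewrite -!comp_assoc; do 2!congr (_ ∘ _); rewrite !comp_assoc smm_nat.
Qed.
Next Obligation.
move=> C R S T b a X Y; rewrite -comp_assoc smm_tau comp_assoc smm_tau.
by rewrite -comp_assoc -tensm_comp comp_idl.
Qed.

Program Definition strong_monads (C : symmetric_monoidal_category) : category :=
  @Category (strong_monad C) (@strong_monad_morphism C)
    (@strong_monad_morphism_id C) (@strong_monad_morphism_comp C) _ _ _.
Next Obligation.
by move=> C S T f; apply: strong_monad_morphism_ext => X; apply: comp_idl.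
Qed.
Next Obligation.
by move=> C S T f; apply: strong_monad_morphism_ext => X; apply: comp_idr.
Qed.
Next Obligation.
by move=> C R S T W h g f; apply: strong_monad_morphism_ext => X;
  apply: comp_assoc.
Qed.

Record commutative_submonad (C : symmetric_monoidal_category)
    (T : strong_monad C) := CommutativeSubmonad {
  submonad :> strong_monad C;
  submonad_commutative : commutative submonad;
  submonad_incl : strong_monad_morphism submonad T;
  submonad_monic : @monic (strong_monads C) submonad T submonad_incl
}.

Record central_cone (C : symmetric_monoidal_category) (T : strong_monad C)
    (X : C) := CentralCone {
  cone_apex : C;
  cone_map : hom cone_apex (T X);
  cone_central : forall Y : C,
    mu T (X ⊗ Y) ∘ fmap T (tau' T X Y) ∘ tau T (T X) Y
      ∘ (cone_map ⊗m idm (T Y))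
    = mu T (X ⊗ Y) ∘ fmap T (tau T X Y) ∘ tau' T X (T Y)
      ∘ (cone_map ⊗m idm (T Y))
}.

Program Definition central_cones (C : symmetric_monoidal_category)
    (T : strong_monad C) (X : C) : category :=
  @Category (central_cone T X)
    (fun c' c => {phi : hom (cone_apex c') (cone_apex c)
                      | cone_map c ∘ phi = cone_map c'})
    (fun c => exist _ (idm (cone_apex c)) _)
    (fun c c' c'' g f => exist _ (sval g ∘ sval f) _) _ _ _.
Next Obligation. by move=> C T X c /=; rewrite comp_idr. Qed.
Next Obligation.
by move=> C T X c c' c'' [g Hg] [f Hf] /=; rewrite comp_assoc Hg.
Qed.
Next Obligation.
by move=> C T X c c' f; apply: eq_sig_hprop => [*|];
  [exact: proof_irrelevance|exact: comp_idl].
Qed.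
Next Obligation.
by move=> C T X c c' f; apply: eq_sig_hprop => [*|];
  [exact: proof_irrelevance|exact: comp_idr].
Qed.
Next Obligation.
by move=> C T X c c' c'' c3 h g f; apply: eq_sig_hprop => [*|];
  [exact: proof_irrelevance|exact: comp_assoc].
Qed.

Definition kcomp (C : category) (T : monad C) (X Y Z : C)
    (g : hom Y (T Z)) (f : hom X (T Y)) : hom X (T Z) :=
  mu T Z ∘ fmap T g ∘ f.

Notation "g ⊙ f" := (kcomp g f) (at level 40, left associativity) : cat_scope.

Program Definition kleisli (C : category) (T : monad C) : category :=
  @Category C (fun X Y => hom X (T Y)) (eta T) (@kcomp C T) _ _ _.
Next Obligation. by move=> C T X Y f; rewrite /kcomp mu_etar comp_idl. Qed.
Next Obligation.
move=> C T X Y f; rewrite /kcomp -comp_assoc -eta_nat comp_assoc mu_etal.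
exact: comp_idl.
Qed.
Next Obligation.
move=> C T X Y Z W h g f; rewrite /kcomp !fmap_comp !comp_assoc -mu_mu.
by rewrite -[mu T W ∘ mu T (T W) ∘ _]comp_assoc mu_nat !comp_assoc.
Qed.

Program Definition kleisli_J (C : category) (T : monad C)
    : functor C (kleisli T) :=
  @Functor C (kleisli T) (fun X => X) (fun X Y f => eta T Y ∘ f) _ _.
Next Obligation. by move=> C T X /=; rewrite comp_idr. Qed.
Next Obligation.
move=> C T X Y Z g f /=; rewrite /kcomp fmap_comp !comp_assoc mu_etar comp_idl.
by rewrite eta_nat.
Qed.

Program Definition kleisli_embedding (C : symmetric_monoidal_category)
    (S T : strong_monad C) (i : strong_monad_morphism S T)
    : functor (kleisli S) (kleisli T) :=
  @Functor (kleisli S) (kleisli T) (fun X => X) (fun X Y f => i Y ∘ f) _ _.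
Next Obligation. by move=> C S T i X /=; rewrite smm_eta. Qed.
Next Obligation.
move=> C S T i X Y Z g f /=; rewrite /kcomp !comp_assoc smm_mu fmap_comp.
rewrite -!comp_assoc; do 2!congr (_ ∘ _).
by rewrite !comp_assoc smm_nat.
Qed.

Section Centre.
Variables (C : symmetric_monoidal_category) (T : strong_monad C).

Definition ltens (Y Z : C) (f : hom Y (T Z)) (X : C)
    : hom (Y ⊗ X) (T (Z ⊗ X)) :=
  tau' T Z X ∘ (f ⊗m idm X).

Definition rtens (X : C) (Y Z : C) (f : hom Y (T Z))
    : hom (X ⊗ Y) (T (X ⊗ Z)) :=
  tau T X Z ∘ (idm X ⊗m f).

(* One interchange equation suffices: the symmetry of C makes the mirrored one,
   with f on the right of the tensor, equivalent to it. *)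
Definition central (X Y : C) (f : hom X (T Y)) : Prop :=
  forall (X' Y' : C) (f' : hom X' (T Y')),
    ltens f Y' ⊙ rtens X f' = rtens Y f' ⊙ ltens f X'.

Lemma tau'_nat (X X' Y Y' : C) (f : hom X X') (g : hom Y Y') :
  tau' T X' Y' ∘ (fmap T f ⊗m g) = fmap T (f ⊗m g) ∘ tau' T X Y.
Proof.
rewrite /tau' -comp_assoc braid_nat comp_assoc -[_ ∘ tau T _ _ ∘ _]comp_assoc.
by rewrite tau_nat !comp_assoc -!fmap_comp braid_nat.
Qed.

Lemma tau'_eta (X Y : C) : tau' T X Y ∘ (eta T X ⊗m idm Y) = eta T (X ⊗ Y).
Proof.
rewrite /tau' -comp_assoc braid_nat comp_assoc -[_ ∘ tau T _ _ ∘ _]comp_assoc.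
by rewrite tau_eta -eta_nat -comp_assoc braidK comp_idr.
Qed.

Lemma tau'_mu (X Y : C) :
  tau' T X Y ∘ (mu T X ⊗m idm Y)
  = mu T (X ⊗ Y) ∘ fmap T (tau' T X Y) ∘ tau' T (T X) Y.
Proof.
rewrite /tau' -comp_assoc braid_nat comp_assoc -[_ ∘ tau T _ _ ∘ _]comp_assoc.
rewrite tau_mu !comp_assoc -mu_nat !fmap_comp -!comp_assoc.
do 3!congr (_ ∘ _).
by rewrite [RHS]comp_assoc -fmap_comp braidK fmap_id comp_idl.
Qed.

Lemma ltens_kcomp (X Y Z W : C) (g : hom Y (T Z)) (f : hom X (T Y)) :
  ltens (g ⊙ f) W = ltens g W ⊙ ltens f W.
Proof.
have tensE (A B D : C) (b : hom B D) (a : hom A B) :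
    (b ∘ a) ⊗m idm W = (b ⊗m idm W) ∘ (a ⊗m idm W).
  by rewrite -tensm_comp comp_idl.
rewrite /ltens /kcomp !tensE !comp_assoc tau'_mu fmap_comp -!comp_assoc.
by do 2!congr (_ ∘ _); rewrite !comp_assoc tau'_nat /tau' !comp_assoc.
Qed.

Lemma kcompA (X Y Z W : C) (h : hom Z (T W)) (g : hom Y (T Z))
    (f : hom X (T Y)) : h ⊙ (g ⊙ f) = h ⊙ g ⊙ f.
Proof. exact: (@comp_assoc (kleisli T)). Qed.

Lemma central_kcomp (X Y Z : C) (g : hom Y (T Z)) (f : hom X (T Y)) :
  central g -> central f -> central (g ⊙ f).
Proof.
move=> cg cf X' Y' f'.
by rewrite !ltens_kcomp -kcompA cf kcompA cg -kcompA.
Qed.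

Lemma central_J (X Y : C) (f : hom X Y) : central (fmap (kleisli_J T) f).
Proof.
move=> X' Y' f' /=.
have ltE (W : C) : ltens (eta T Y ∘ f) W = eta T (Y ⊗ W) ∘ (f ⊗m idm W).
  by rewrite /ltens -{1}[idm W]comp_idl tensm_comp comp_assoc tau'_eta.
rewrite !ltE /kcomp fmap_comp !comp_assoc mu_etar comp_idl.
rewrite -[_ ∘ eta T _]comp_assoc -eta_nat comp_assoc mu_etal comp_idl.
rewrite /rtens ?comp_assoc -tau_nat -!comp_assoc -!tensm_comp.
by rewrite fmap_id !comp_idl !comp_idr.
Qed.

Lemma central_eta (X : C) : central (eta T X).
Proof. by rewrite -[eta T X]comp_idr; apply: central_J. Qed.

Definition centre : category :=
  @wide_subcategory (kleisli T) central central_eta central_kcomp.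

Definition centre_corestriction (D : category) (F : functor D (kleisli T))
    (F_central : forall (X Y : D) (f : hom X Y), central (fmap F f))
    : functor D centre :=
  @corestriction (kleisli T) central central_eta central_kcomp D F F_central.

Definition J_hat : functor C centre := centre_corestriction central_J.

End Centre.

(* Main.v *)
Require Import Defs.
From Stdlib Require Import FunctionalExtensionality ProofIrrelevance.
From Stdlib Require Import ClassicalEpsilon.

Set Implicit Arguments.
Unset Strict Implicit.
Unset Printing Implicit Defensive.
#[local] Obligation Tactic := idtac.
Local Open Scope cat_scope.

(** A central cone at [X] is the same thing as a central Kleisli morphism into
    [X], so a terminal central cone is a central [i : W -> T X] through which
    every central morphism into [X] factors uniquely; call such an [i]
    universal.  By the Yoneda lemma a family of universal morphisms amounts to
    a right adjoint of [J_hat], with the family as counit.  Central morphisms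
    contain the unit and are closed under Kleisli composition and under
    tensoring with an object, so the monad structure of [T] restricts uniquely
    along the monic family [i], and it becomes commutative because [i] is
    central.  Conversely, full faithfulness of [C_Z -> Z(C_T)] says precisely
    that the components of [Z -> T] are universal. *)

(** * Equality in subtypes and of functors; cancellation of isomorphisms *)

Lemma sval_inj (A : Type) (P : A -> Prop) : injective (@proj1_sig A P).
Proof.
by move=> [x p] [y q] /= xy; subst y; f_equal; apply: proof_irrelevance.
Qed.

(** Sharing the object map [o] gives both morphism parts the same type, so no transport along an
    equality of objects is needed. *)
Lemma functor_ext (C D : category) (o : C -> D)
    (m m' : forall X Y : C, hom X Y -> hom (o X) (o Y)) p q p' q' :
  (forall X Y (f : hom X Y), m X Y f = m' X Y f) ->
  @Functor C D o m p q = @Functor C D o m' p' q'.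
Proof.
move=> mm'; have {}mm' : m = m'.
  apply: functional_extensionality_dep => X.
  apply: functional_extensionality_dep => Y.
  by apply: functional_extensionality => f.
by subst m'; f_equal; apply: proof_irrelevance.
Qed.

Lemma cat_isomorphism_faithful (C D : category) (F : functor C D) :
  is_cat_isomorphism F -> forall X Y : C, injective (@fmap C D F X Y).
Proof.
case=> G [GF _] X Y f g fg.
(* With the composite generalised to a variable [H], the equality of functors can be eliminated by
   rewriting even though it also identifies objects. *)
have idP (H : functor C C) : H = functor_id C -> injective (@fmap C C H X Y).
  by move=> ->.
by apply: (idP _ GF); rewrite /= fg.
Qed.

(** The preimage is [fmap G h] read along [GF]. That [F] sends it to [h] is checked after applying
    [G], which is faithful, being an isomorphism too. *)
Lemma cat_isomorphism_full (C D : category) (F : functor C D) :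
  is_cat_isomorphism F ->
  forall (X Y : C) (h : hom (F X) (F Y)), exists f : hom X Y, fmap F f = h.
Proof.
case=> G [GF FG] X Y h.
have G_iso : is_cat_isomorphism G by exists F.
have idP (H : functor C C) : H = functor_id C ->
    forall k : hom (H X) (H Y), exists f, fmap H f = k.
  by move=> -> k; exists k.
have [f fE] := idP _ GF (fmap G h).
by exists f; apply: (cat_isomorphism_faithful G_iso).
Qed.

Lemma iso_epi (C : category) (X Y Z : C) (e : hom X Y) (f g : hom Y Z) :
  is_iso e -> f ∘ e = g ∘ e -> f = g.
Proof.
case=> e' [_ ee'] fg.
by rewrite -[f]comp_idr -[g]comp_idr -ee' !comp_assoc fg.
Qed.

Lemma iso_mono (C : category) (X Y Z : C) (e : hom Y Z) (f g : hom X Y) :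
  is_iso e -> e ∘ f = e ∘ g -> f = g.
Proof.
case=> e' [e'e _] fg.
by rewrite -[f]comp_idl -[g]comp_idl -e'e -!comp_assoc fg.
Qed.

Lemma braid_iso (C : symmetric_monoidal_category) (X Y : C) :
  is_iso (braid X Y).
Proof. by exists (braid Y X); split; apply: braidK. Qed.

Lemma fmap_iso (C D : category) (F : functor C D) (X Y : C) (f : hom X Y) :
  is_iso f -> is_iso (fmap F f).
Proof.
by case=> g [gf fg]; exists (fmap F g); rewrite -!fmap_comp gf fg !fmap_id.
Qed.

(** * Kleisli composition, strengths, and closure of central morphisms *)

Section KleisliTensor.
Variables (C : symmetric_monoidal_category) (T : strong_monad C).

Lemma kcomp_eta_r (X Y Z : C) (g : hom Y (T Z)) (f : hom X Y) :
  g ⊙ (eta T Y ∘ f) = g ∘ f.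
Proof.
rewrite /kcomp comp_assoc -[_ ∘ fmap T g ∘ _]comp_assoc -eta_nat comp_assoc.
by rewrite mu_etal comp_idl.
Qed.

Lemma kcomp_eta_l (X Y Z : C) (g : hom Y Z) (f : hom X (T Y)) :
  (eta T Z ∘ g) ⊙ f = fmap T g ∘ f.
Proof. by rewrite /kcomp fmap_comp comp_assoc mu_etar comp_idl. Qed.

Lemma kcomp_comp_r (X Y Z W : C) (h : hom Z (T W)) (g : hom Y (T Z))
    (f : hom X Y) : h ⊙ g ∘ f = h ⊙ (g ∘ f).
Proof. by rewrite /kcomp comp_assoc. Qed.

Lemma kcomp_fmap (X Y Z W : C) (h : hom Z (T W)) (g : hom Y Z)
    (f : hom X (T Y)) : h ⊙ (fmap T g ∘ f) = (h ∘ g) ⊙ f.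
Proof. by rewrite /kcomp fmap_comp !comp_assoc. Qed.

Lemma fmap_kcomp (X Y Z W : C) (h : hom Z W) (g : hom Y (T Z))
    (f : hom X (T Y)) : fmap T h ∘ (g ⊙ f) = (fmap T h ∘ g) ⊙ f.
Proof. by rewrite -!kcomp_eta_l kcompA. Qed.

Lemma rtens_kcomp (A X Y Z : C) (g : hom Y (T Z)) (f : hom X (T Y)) :
  rtens A (g ⊙ f) = rtens A g ⊙ rtens A f.
Proof.
have tensE (U V W : C) (b : hom V W) (a : hom U V) :
    idm A ⊗m (b ∘ a) = (idm A ⊗m b) ∘ (idm A ⊗m a).
  by rewrite -tensm_comp comp_idl.
rewrite /rtens /kcomp !tensE !comp_assoc tau_mu fmap_comp -!comp_assoc.
by do 2!congr (_ ∘ _); rewrite !comp_assoc tau_nat.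
Qed.

Lemma rtens_assoc (A X Y Z : C) (f : hom Y (T Z)) :
  fmap T (assoc A X Z) ∘ rtens (A ⊗ X) f = rtens A (rtens X f) ∘ assoc A X Y.
Proof.
rewrite /rtens comp_assoc tau_assoc -!comp_assoc -tensm_id assoc_nat.
rewrite !comp_assoc; congr (_ ∘ _); rewrite -!comp_assoc.
by rewrite -tensm_comp comp_idl.
Qed.

(** Since [tau'] is [tau] conjugated by braidings, precomposing with isomorphisms that start from
    [W] in front leaves only [tau]. The hexagons for [W, A, Y] and [W, A, T Y] then match both sides
    through [tau_assoc]. *)
Lemma tau'_tau_assoc (A Y W : C) :
  fmap T (assoc A Y W) ∘ tau' T (A ⊗ Y) W ∘ (tau T A Y ⊗m idm W)
  = tau T A (Y ⊗ W) ∘ (idm A ⊗m tau' T Y W) ∘ assoc A (T Y) W.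
Proof.
apply: (iso_epi (braid_iso W (A ⊗ T Y))).
apply: (iso_epi (assoc_iso W A (T Y))).
(* The middle term applies the strength of [W ⊗ A] at once and permutes the factors only afterwards,
   under [T]. *)
transitivity (fmap T (assoc A Y W ∘ braid W (A ⊗ Y) ∘ assoc W A Y)
              ∘ tau T (W ⊗ A) Y).
  rewrite fmap_comp -[RHS]comp_assoc tau_assoc /tau' !comp_assoc.
  rewrite -[_ ∘ braid _ _ ∘ (_ ⊗m _)]comp_assoc braid_nat !fmap_comp.
  rewrite -!comp_assoc; do 4!congr (_ ∘ _).
  by rewrite comp_assoc braidK comp_idl.
rewrite hexagon fmap_comp -comp_assoc -tau_nat fmap_comp fmap_id.
rewrite !comp_assoc -[_ ∘ _ ∘ tau T (A ⊗ W) Y]comp_assoc tau_assoc.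
rewrite -[RHS]comp_assoc -[RHS]comp_assoc [X in _ = _ ∘ X]comp_assoc hexagon.
rewrite !comp_assoc -tau_nat; do 2!congr (_ ∘ _).
rewrite -!comp_assoc -!tensm_comp !comp_idl /tau'.
by rewrite -!comp_assoc braidK comp_idr.
Qed.

Lemma ltens_rtens_assoc (A X Y W : C) (f : hom X (T Y)) :
  fmap T (assoc A Y W) ∘ ltens (rtens A f) W
  = rtens A (ltens f W) ∘ assoc A X W.
Proof.
have tensE : rtens A f ⊗m idm W
    = (tau T A Y ⊗m idm W) ∘ ((idm A ⊗m f) ⊗m idm W).
  by rewrite -tensm_comp comp_idl.
rewrite /ltens tensE [X in fmap T _ ∘ X]comp_assoc [LHS]comp_assoc.
rewrite [X in X ∘ _]comp_assoc tau'_tau_assoc /rtens -!comp_assoc assoc_nat.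
by congr (_ ∘ _); rewrite comp_assoc -tensm_comp comp_idl /tau' -!comp_assoc.
Qed.

(** Up to associators, interchanging [rtens A f] with [f'] is the image under [rtens A] of
    interchanging [f] with [f'], because [rtens A] respects Kleisli composition. *)
Lemma central_rtens (A X Y : C) (f : hom X (T Y)) :
  central f -> central (rtens A f).
Proof.
move=> cf X' Y' f'.
apply: (iso_mono (fmap_iso T (assoc_iso A Y Y'))).
rewrite !fmap_kcomp ltens_rtens_assoc rtens_assoc.
rewrite -[LHS]kcomp_fmap -[RHS]kcomp_fmap.
rewrite rtens_assoc ltens_rtens_assoc -[LHS]kcomp_comp_r -[RHS]kcomp_comp_r.
by rewrite -!rtens_kcomp cf.
Qed.

Lemma central_comp (X Y Z : C) (g : hom Y (T Z)) (f : hom X Y) :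
  central g -> central (g ∘ f).
Proof.
by move=> cg; rewrite -kcomp_eta_r; apply: central_kcomp => //; apply: central_J.
Qed.

Lemma central_fmap (X Y Z : C) (g : hom Y Z) (f : hom X (T Y)) :
  central f -> central (fmap T g ∘ f).
Proof.
by move=> cf; rewrite -kcomp_eta_l; apply: central_kcomp => //; apply: central_J.
Qed.

(** Naturality of the strength isolates [f'] as a final precomposition, so that the interchange law
    can be tested at a single generic [f']. *)
Lemma ltens_kcomp_rtens (X Y X' Y' : C) (f : hom X (T Y)) (f' : hom X' (T Y')) :
  ltens f Y' ⊙ rtens X f'
  = mu T (Y ⊗ Y') ∘ fmap T (tau' T Y Y') ∘ tau T (T Y) Y'
    ∘ (f ⊗m idm (T Y')) ∘ (idm X ⊗m f').
Proof.
rewrite /kcomp /ltens /rtens fmap_comp !comp_assoc; congr (_ ∘ _).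
by rewrite -!comp_assoc -tau_nat fmap_id.
Qed.

Lemma rtens_kcomp_ltens (X Y X' Y' : C) (f : hom X (T Y)) (f' : hom X' (T Y')) :
  rtens Y f' ⊙ ltens f X'
  = mu T (Y ⊗ Y') ∘ fmap T (tau T Y Y') ∘ tau' T Y (T Y')
    ∘ (f ⊗m idm (T Y')) ∘ (idm X ⊗m f').
Proof.
transitivity (mu T (Y ⊗ Y') ∘ fmap T (tau T Y Y')
              ∘ (fmap T (idm Y ⊗m f') ∘ tau' T Y X') ∘ (f ⊗m idm X')).
  by rewrite /kcomp /ltens /rtens fmap_comp !comp_assoc.
rewrite -tau'_nat fmap_id -!comp_assoc; do 5!congr (_ ∘ _).
by rewrite -!tensm_comp !comp_idl !comp_idr.
Qed.

(** * Central cones, universal central morphisms and counits *)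

Lemma central_cone_conditionP (X W : C) (i : hom W (T X)) :
  central i <->
  forall Y : C,
    mu T (X ⊗ Y) ∘ fmap T (tau' T X Y) ∘ tau T (T X) Y ∘ (i ⊗m idm (T Y))
    = mu T (X ⊗ Y) ∘ fmap T (tau T X Y) ∘ tau' T X (T Y) ∘ (i ⊗m idm (T Y)).
Proof.
split=> [ci Y|ci X' Y' f'].
  (* The identity of [T Y], read as a Kleisli morphism from [T Y] to [Y], is the generic test
     morphism. *)
  have := ci _ _ (idm (T Y)).
  by rewrite ltens_kcomp_rtens rtens_kcomp_ltens tensm_id !comp_idr.
by rewrite ltens_kcomp_rtens rtens_kcomp_ltens ci.
Qed.

Definition universal_central (X W : C) (i : hom W (T X)) : Prop :=
  central i /\
  forall (V : C) (f : hom V (T X)), central f -> exists! g : hom V W, i ∘ g = f.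

Lemma terminal_universal_central (X : C) (c : central_cones T X) :
  terminal c -> universal_central (cone_map c).
Proof.
move=> ct; split=> [|V f cf]; first exact/central_cone_conditionP/cone_central.
have [[g gE] [_ g_uniq]] :=
  ct (CentralCone (proj1 (central_cone_conditionP f) cf)).
exists g; split=> [//|g' g'E].
exact: (f_equal sval (g_uniq (exist _ g' g'E) I)).
Qed.

Lemma universal_central_terminal (X W : C) (i : hom W (T X)) :
  universal_central i -> exists c : central_cones T X, terminal c.
Proof.
move=> [ci iU].
exists (CentralCone (proj1 (central_cone_conditionP i) ci)) => -[V f cf].
have [g [gE g_uniq]] := iU V f (proj2 (central_cone_conditionP f) cf).
exists (exist _ g gE); split=> // -[g' g'E] _.
by apply: sval_inj; apply: g_uniq.
Qed.

(** The morphism in question is the counit at [X], and a central [f] factors through it by its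
    transpose. *)
Lemma adjunction_universal_central (G : functor (centre T) C)
    (A : adjunction (J_hat T) G) (X : C) :
  universal_central (sval (adj_rl A (idm (G X)))).
Proof.
set e := adj_rl A _.
have adj_lr_counit (V : C) (g : hom V (G X)) :
    adj_lr A (e ∘ fmap (J_hat T) g) = g.
  by rewrite -[e]comp_idl adj_nat fmap_id comp_idl adj_rlK comp_idl.
split=> [|V f cf]; first exact: svalP.
(* Kleisli precomposition with a pure morphism is plain precomposition, so factoring through the
   counit in [centre T] is factoring in [C]. *)
have svalE (g : hom V (G X)) :
    sval (e ∘ fmap (J_hat T) g) = (sval e : @hom C (G X) (T X)) ∘ g.
  exact: kcomp_eta_r.
pose fc : hom (J_hat T V) X := exist _ f cf.
exists (adj_lr A fc); split=> [|g gE].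
  rewrite -svalE -[f]/(sval fc); congr sval.
  by rewrite -[LHS](adj_lrK A) adj_lr_counit adj_lrK.
rewrite -[RHS]adj_lr_counit; congr (adj_lr A _).
by apply: sval_inj; rewrite svalE gE.
Qed.

End KleisliTensor.

(** * The commutative submonad cut out by a universal family *)

Section UniversalFamily.
Variables (C : symmetric_monoidal_category) (T : strong_monad C).
Variables (Z : C -> C) (i : forall X : C, hom (Z X) (T X)).
Hypothesis iU : forall X : C, universal_central (i X).

Lemma universal_is_central (X : C) : central (i X).
Proof. exact: (proj1 (iU X)). Qed.

(** Uniqueness of factorisations is available only for central morphisms, but [i X ∘ b] is central
    for every [b]. *)
Lemma universal_monic (X : C) : monic (i X).
Proof.
move=> W a b ab.
have [g [_ g_uniq]] := proj2 (iU X) W _ (central_comp b (universal_is_central X)).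
by rewrite -(g_uniq a ab) -(g_uniq b erefl).
Qed.

Definition lift (V X : C) (f : hom V (T X)) (cf : central f) : hom V (Z X) :=
  sval (constructive_definite_description _ (proj2 (iU X) V f cf)).

Lemma liftE (V X : C) (f : hom V (T X)) (cf : central f) :
  i X ∘ lift cf = f.
Proof. by rewrite /lift; case: constructive_definite_description. Qed.

Definition centre_fmap (X Y : C) (f : hom X Y) : hom (Z X) (Z Y) :=
  lift (central_fmap f (universal_is_central X)).

Lemma centre_fmapE (X Y : C) (f : hom X Y) :
  i Y ∘ centre_fmap f = fmap T f ∘ i X.
Proof. exact: liftE. Qed.

Program Definition centre_functor : functor C C :=
  @Functor C C Z centre_fmap _ _.
Next Obligation.
move=> X; apply: (@universal_monic).
by rewrite centre_fmapE fmap_id comp_idl comp_idr.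
Qed.
Next Obligation.
move=> X Y W g f; apply: (@universal_monic).
rewrite centre_fmapE fmap_comp comp_assoc centre_fmapE.
by rewrite -!comp_assoc centre_fmapE.
Qed.

Definition centre_eta (X : C) : hom X (Z X) := lift (@central_eta C T X).

Lemma centre_etaE (X : C) : i X ∘ centre_eta X = eta T X.
Proof. exact: liftE. Qed.

Definition centre_mu (X : C) : hom (Z (Z X)) (Z X) :=
  lift (central_kcomp (universal_is_central X) (universal_is_central (Z X))).

Lemma centre_muE (X : C) : i X ∘ centre_mu X = i X ⊙ i (Z X).
Proof. exact: liftE. Qed.

(** This is compatibility of [i] with Kleisli composition, spelled out because the monad laws for
    [Z] are not yet established. *)
Lemma centre_kcompE (X Y W : C) (g : hom Y (Z W)) (f : hom X (Z Y)) :
  i W ∘ (centre_mu W ∘ centre_fmap g ∘ f) = (i W ∘ g) ⊙ (i Y ∘ f).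
Proof.
rewrite !comp_assoc centre_muE !kcomp_comp_r centre_fmapE.
by rewrite -[fmap T g ∘ i Y ∘ f]comp_assoc kcomp_fmap.
Qed.

Program Definition centre_monad : monad C :=
  @Monad C centre_functor centre_eta centre_mu _ _ _ _ _.
Next Obligation.
move=> X Y f /=; apply: (@universal_monic).
by rewrite !comp_assoc centre_etaE centre_fmapE -comp_assoc centre_etaE eta_nat.
Qed.
Next Obligation.
move=> X Y f /=; apply: (@universal_monic).
rewrite !comp_assoc centre_muE kcomp_comp_r !centre_fmapE kcomp_fmap.
by rewrite centre_fmapE -comp_assoc centre_muE fmap_kcomp.
Qed.
Next Obligation.
move=> X /=; apply: (@universal_monic).
rewrite comp_assoc centre_muE kcomp_comp_r centre_etaE comp_idr.
exact: (@comp_idr (kleisli T)).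
Qed.
Next Obligation.
move=> X /=; apply: (@universal_monic).
rewrite comp_assoc centre_muE kcomp_comp_r centre_fmapE kcomp_fmap centre_etaE.
rewrite comp_idr; exact: (@comp_idl (kleisli T)).
Qed.
Next Obligation.
move=> X /=; apply: (@universal_monic).
rewrite !comp_assoc centre_muE !kcomp_comp_r centre_muE centre_fmapE kcomp_fmap.
by rewrite centre_muE kcompA.
Qed.

Definition centre_tau (X Y : C) : hom (X ⊗ Z Y) (Z (X ⊗ Y)) :=
  lift (central_rtens X (universal_is_central Y)).

Lemma centre_tauE (X Y : C) :
  i (X ⊗ Y) ∘ centre_tau X Y = tau T X Y ∘ (idm X ⊗m i Y).
Proof. exact: liftE. Qed.

Lemma centre_tau_tensE (X Y W : C) (g : hom W (Z Y)) :
  i (X ⊗ Y) ∘ (centre_tau X Y ∘ (idm X ⊗m g)) = rtens X (i Y ∘ g).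
Proof. by rewrite comp_assoc centre_tauE -comp_assoc -tensm_comp comp_idl. Qed.

Program Definition centre_strong_monad : strong_monad C :=
  @StrongMonad C centre_monad centre_tau _ _ _ _ _.
Next Obligation.
move=> X X' Y Y' f g /=; apply: (@universal_monic).
rewrite !comp_assoc centre_tauE centre_fmapE -[RHS]comp_assoc centre_tauE.
rewrite comp_assoc -tau_nat -!comp_assoc -!tensm_comp.
by rewrite centre_fmapE comp_idl comp_idr.
Qed.
Next Obligation.
move=> X /=; apply: (@universal_monic).
rewrite comp_assoc centre_fmapE -comp_assoc centre_tauE comp_assoc tau_lunit.
exact: lunit_nat.
Qed.
Next Obligation.
move=> X Y W /=; apply: (@universal_monic).
rewrite !comp_assoc centre_fmapE -comp_assoc centre_tauE.
rewrite -[_ ∘ (idm X ⊗m _)]comp_assoc centre_tau_tensE centre_tauE.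
by rewrite rtens_assoc.
Qed.
Next Obligation.
move=> X Y /=; apply: (@universal_monic).
by rewrite centre_tau_tensE centre_etaE /rtens tau_eta centre_etaE.
Qed.
Next Obligation.
move=> X Y /=; apply: (@universal_monic).
by rewrite centre_tau_tensE centre_muE centre_kcompE !centre_tauE rtens_kcomp.
Qed.

Definition centre_incl : strong_monad_morphism centre_strong_monad T :=
  @StrongMonadMorphism C centre_strong_monad T i
    centre_fmapE centre_etaE centre_muE centre_tauE.

Lemma centre_tau'E (X Y : C) :
  i (X ⊗ Y) ∘ tau' centre_strong_monad X Y = ltens (i X) Y.
Proof.
rewrite /tau' /= /ltens /tau' !comp_assoc centre_fmapE.
rewrite -[_ ∘ braid _ _ ∘ (_ ⊗m _)]comp_assoc braid_nat comp_assoc.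
congr (_ ∘ _); rewrite -!comp_assoc; congr (_ ∘ _).
exact: centre_tauE.
Qed.

(** Seen through the monic [i], the two sides are the two composites in the interchange law of [i X]
    with [i Y]. *)
Lemma centre_commutative : commutative centre_strong_monad.
Proof.
move=> X Y /=; apply: (@universal_monic).
rewrite !centre_kcompE !centre_tauE !centre_tau'E.
exact: universal_is_central.
Qed.

Lemma centre_incl_monic :
  @monic (strong_monads C) centre_strong_monad T centre_incl.
Proof.
move=> S a b ab; apply: strong_monad_morphism_ext => X.
apply: (@universal_monic).
exact: (f_equal (fun m : strong_monad_morphism S T => m X) ab).
Qed.

Definition centre_submonad : commutative_submonad T :=
  CommutativeSubmonad centre_commutative centre_incl_monic.

(** * The Kleisli category of the submonad as the centre, and the right adjoint of [J_hat] *)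

Lemma centre_embedding_central (X Y : kleisli centre_submonad)
    (f : hom X Y) :
  central (fmap (kleisli_embedding (submonad_incl centre_submonad)) f).
Proof. exact: (central_comp f (universal_is_central Y)). Qed.

Program Definition centre_to_kleisli :
    functor (centre T) (kleisli centre_submonad) :=
  @Functor (centre T) (kleisli centre_submonad) (fun X => X)
    (fun X Y f => lift (svalP f)) _ _.
Next Obligation.
by move=> X /=; apply: (@universal_monic); rewrite liftE centre_etaE.
Qed.
Next Obligation.
move=> X Y W g f /=; apply: (@universal_monic).
by rewrite liftE [kcomp in RHS]/kcomp /= centre_kcompE !liftE.
Qed.

(** Both functors are the identity on objects; on morphisms, lifting along [i] inverts composing
    with [i]. *)
Lemma centre_embedding_iso :
  is_cat_isomorphism (centre_corestriction centre_embedding_central).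
Proof.
exists centre_to_kleisli; split; apply: functor_ext => X Y f /=.
  by apply: (@universal_monic); rewrite liftE.
by apply: sval_inj; apply: liftE.
Qed.

(** The action on morphisms is the only one that makes [i] natural as a counit. *)
Program Definition J_hat_right_adjoint : functor (centre T) C :=
  @Functor (centre T) C Z
    (fun X Y f => lift (central_kcomp (svalP f) (universal_is_central X))) _ _.
Next Obligation.
move=> X /=; apply: (@universal_monic); rewrite liftE comp_idr.
exact: (@comp_idl (kleisli T)).
Qed.
Next Obligation.
move=> X Y W g f /=; apply: (@universal_monic).
by rewrite comp_assoc !liftE kcomp_comp_r liftE kcompA.
Qed.

Program Definition J_hat_adjunction : adjunction (J_hat T) J_hat_right_adjoint :=
  @Adjunction C (centre T) (J_hat T) J_hat_right_adjoint
    (fun X Y f => lift (svalP f))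
    (fun X Y g => exist _ (i Y ∘ g) (central_comp g (universal_is_central Y)))
    _ _ _.
Next Obligation. by move=> X Y f; apply: sval_inj; apply: liftE. Qed.
Next Obligation.
by move=> X Y g; apply: (@universal_monic); rewrite liftE.
Qed.
Next Obligation.
move=> X X' Y Y' a f b /=; apply: (@universal_monic).
rewrite !comp_assoc !liftE kcomp_eta_r !kcomp_comp_r.
by rewrite liftE.
Qed.

End UniversalFamily.

(** * Universality from an isomorphism with the centre, and the equivalence *)

Lemma submonad_universal_central (C : symmetric_monoidal_category)
    (T : strong_monad C) (Z : commutative_submonad T)
    (I_central : forall (X Y : kleisli Z) (f : hom X Y),
       central (fmap (kleisli_embedding (submonad_incl Z)) f)) :
  is_cat_isomorphism (centre_corestriction I_central) ->
  forall X : C, universal_central (submonad_incl Z X).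
Proof.
move=> Iiso X; split=> [|V f cf].
  (* The identity of [Z X] is a Kleisli morphism from [Z X] to [X], and the embedding sends it to
     the inclusion itself. *)
  by have := I_central (Z X) X (idm (Z X)); rewrite /= comp_idr.
pose fc : @hom (centre T) V X := exist _ f cf.
have [g gE] := cat_isomorphism_full Iiso (X := V) (Y := X) fc.
exists g; split=> [|g' g'E]; first exact: (f_equal sval gE).
apply: (cat_isomorphism_faithful Iiso (X := V) (Y := X)).
by rewrite gE; apply: sval_inj.
Qed.

Theorem theorem2p11 (C : symmetric_monoidal_category) (T : strong_monad C) :
  [<-> (forall X : C, exists c : central_cones T X, terminal c);
       (exists (Z : commutative_submonad T)
               (I_central : forall (X Y : kleisli Z) (f : hom X Y),
                 central (fmap (kleisli_embedding (submonad_incl Z)) f)),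
          is_cat_isomorphism (centre_corestriction I_central));
       is_left_adjoint (J_hat T)].
Proof.
tfae.
- move=> cones.
  (* Terminal cones are unique only up to isomorphism, so choice is used to collect one per object
     into a family. *)
  pose c X := sval (constructive_indefinite_description _ (cones X)).
  have cU X : universal_central (cone_map (c X)).
    apply: terminal_universal_central.
    by rewrite /c; case: constructive_indefinite_description.
  exists (centre_submonad cU), (@centre_embedding_central _ _ _ _ cU).
  exact: centre_embedding_iso.
- move=> [Z [I_central /submonad_universal_central iU]].
  by exists (J_hat_right_adjoint iU); constructor; apply: J_hat_adjunction.
- move=> [G [A]] X.
  exact: universal_central_terminal (adjunction_universal_central A X).
Qed.
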